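(* Let $q$ and $v$ be real numbers with $q>1$ and $0<v<q$. Then $M_{v,q}$ is a probability measure on the set of all partitions of all non-negative integers.
   Context: A partition $\lambda=(\lambda_1\ge\lambda_2\ge\cdots)$ has size $|\lambda|=\sum_i\lambda_i$ and is identified with its Young diagram; the empty partition is allowed; $\lambda'$ denotes the conjugate partition. For a box $x=(i,j)\in\lambda$ the hook-length is $h(x)=\lambda_i+\lambda'_j-i-j+1$. Put $n(\lambda')=\sum_i\lambda_i(\lambda_i-1)/2$. For real $q>1$ and $0<v<q$, the measure $M_{v,q}$ on the set of all partitions of all non-negative integers is defined by $$M_{v,q}(\lambda)=\prod_{r=1}^\infty\left(1-vq^{-r}\right)^r\, q^{2n(\lambda')+|\lambda|}\prod_{x\in\lambda}\left(q^{h(x)}-1\right)^{-2}v^{|\lambda|}.$$ *)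

(* Defs.v *)
From HB Require Import structures.
From mathcomp Require Import all_boot all_order all_algebra.
From mathcomp Require Import all_classical all_reals all_analysis.
Set Implicit Arguments.
Unset Strict Implicit.
Unset Printing Implicit Defensive.
Import Order.TTheory GRing.Theory Num.Theory.
Import numFieldNormedType.Exports.
Local Open Scope classical_set_scope.
Local Open Scope ring_scope.

(* A partition is the finite, weakly decreasing list of its nonzero parts.
   Rows and columns of its Young diagram are indexed from 0. *)
Definition is_intpart (s : seq nat) : bool := sorted geq s && (0%N \notin s).

Record intpart := IntPart {
  parts :> seq nat;
  partsP : is_intpart parts }.

HB.instance Definition _ := [isSub for parts].
HB.instance Definition _ := [Countable of intpart by <:].

Definition empty_intpart : intpart := @IntPart [::] isT.
HB.instance Definition _ := isPointed.Build intpart empty_intpart.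

(* The set of all partitions is countable: every subset is measurable. *)
HB.instance Definition _ := @isMeasurable.Build default_measure_display
  intpart discrete_measurable discrete_measurable0
  discrete_measurableC discrete_measurableU.

Definition part_size (la : intpart) : nat := sumn la.

Definition part (la : intpart) (i : nat) : nat := nth 0%N la i.

(* The j-th part of the conjugate partition is the length of column j,
   i.e. the number of rows having a box in column j. *)
Definition conj_part (la : intpart) (j : nat) : nat :=
  count (fun p => (j < p)%N) la.

(* With 0-based indices, la_i + la'_j - i - j + 1 becomes
   la_i + la'_j - i - j - 1; for a box (i, j) of la the truncated
   subtraction is exact and the value is positive. *)
Definition hook (la : intpart) (i j : nat) : nat :=
  (part la i + conj_part la j - i - j - 1)%N.

(* n(la') = sum_i la_i (la_i - 1) / 2; each division is exact. *)
Definition n_conj (la : intpart) : nat :=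
  (\sum_(i < size la) (part la i * (part la i - 1)) %/ 2)%N.

Definition M_prefactor (R : realType) (v q : R) : R :=
  lim ((fun N : nat => \prod_(1 <= r < N.+1) (1 - v * q ^- r) ^+ r) @ \oo).

(* The double product ranges over the boxes (i, j) of the diagram of la. *)
Definition M (R : realType) (v q : R) (la : intpart) : R :=
  M_prefactor v q
  * q ^+ (2 * n_conj la + part_size la)
  * (\prod_(i < size la) \prod_(j < part la i) (q ^+ hook la i j - 1) ^- 2)
  * v ^+ part_size la.

(* Main.v *)
From HB Require Import structures.
Require Import Defs.
From mathcomp Require Import all_boot all_order all_algebra.
From mathcomp Require Import all_classical all_reals all_analysis.
From mathcomp Require Import ring zify.
Import Order.TTheory GRing.Theory Num.Theory.
Import numFieldNormedType.Exports.
Local Open Scope classical_set_scope.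
Local Open Scope ring_scope.
Set Implicit Arguments.
Unset Strict Implicit.
Unset Printing Implicit Defensive.

(** Put t = 1/q and u = v t, so that 0 < t < 1 and 0 < u < 1, and let
    g(la) = q^(n(la') + |la|) / prod_x (q^h(x) - 1), which is the Schur function
    of la at (1, t, t^2, ...) ([principal]).  Then M(la) = C u^|la| g(la)^2, where C is the
    infinite product, and the claim is the Cauchy identity
    F(u) := sum_la u^|la| g(la)^2 = 1/C.

    Everything rests on two rules for interlacing partitions
    (la_(i+1) <= mu_i <= la_i for all i, written mu < la below):
      - branching:  sum_(mu < la) t^|mu| g(mu) = g(la);
      - Pieri:      sum_(la > mu) z^|la| g(la) = H(z) z^|mu| g(mu),
        where H(z) = sum_k z^k h_k ([hsum], with partial sums [psum]) and
        h_k = prod_(1 <= i <= k) 1 / (1 - t^i) ([homog]).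
    Replacing one factor g(la) of F(u) by the branching sum, exchanging the two
    sums and applying the Pieri rule gives F(u) = H(u) F(u t), hence
    F(u) = prod_(k >= 0) H(u t^k).  As (1 - z) H(z) = H(z t), the partial product
    over k < K, times D_K = prod_(r <= K) (1 - u t^(r-1))^r, is H(u t^K)^K, which
    tends to 1; and D_K tends to C.

    Both rules are instances of one determinantal computation.  The
    Jacobi-Trudi formula g(la) = det (h_(la_i - i + j)) is proved by deleting
    the first column of the diagram ([jt_mx_shift], [principal_del_col],
    [det_jt_principal]).  Summing this determinant over all f with
    nu_(i+1) <= f_i <= nu_i, weighted by z^|f|, can be done row by row since the
    f_i vary independently: each row telescopes to a difference of two
    consecutive rows of the matrix of partial sums of H ([strip_det]).  With
    nu = la and z = t this is branching; with nu = (n, mu_0, mu_1, ...) and n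
    going to infinity it is the Pieri rule ([pieri_det], [pieri_cvg]).

    To stay within finite sums, F is only ever evaluated on the set of
    partitions whose diagram fits in an N x n box.  There the first step of the
    argument yields inequalities in both directions ([gen_sum_le_step],
    [gen_sum_gt_step]), which bound all finite partial sums of C F(u) by 1 and
    bring some of them arbitrarily close to 1. *)

(** * Partitions inside a box *)

Lemma part_geq (la : intpart) i j : (i <= j)%N -> (part la j <= part la i)%N.
Proof.
move=> ij; rewrite /part; have [js|js] := ltnP j (size la); last first.
  by rewrite [X in (X <= _)%N]nth_default.
have /andP[sla _] := partsP la.
have geq_tr : transitive geq by move=> a b c ab bc; apply: leq_trans bc ab.
have := sorted_leq_nth geq_tr leqnn 0%N sla; apply => //.
by rewrite inE (leq_ltn_trans ij).
Qed.

Lemma part_default (la : intpart) i : (size la <= i)%N -> part la i = 0%N.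
Proof. exact: nth_default. Qed.

Lemma intpart_gt0 (la : intpart) i : (0 < part la i)%N = (i < size la)%N.
Proof.
have [isz|szi] := ltnP i (size la); last by rewrite part_default.
have /andP[_ la0] := partsP la.
by rewrite lt0n; apply: contraNneq la0 => <-; apply: mem_nth.
Qed.

Lemma intpart_ext (la mu : intpart) : part la =1 part mu -> la = mu.
Proof.
move=> lamu.
have size_le (a b : intpart) : part a =1 part b -> (size a <= size b)%N.
  by move=> ab; rewrite leqNgt -intpart_gt0 ab intpart_gt0 ltnn.
apply: val_inj; apply: (@eq_from_nth _ 0%N) => [|i _]; last exact: lamu.
by apply/eqP; rewrite eqn_leq !size_le // => i; rewrite lamu.
Qed.

Lemma sort_filter_intpart (s : seq nat) : is_intpart (sort geq [seq k <- s | k != 0%N]).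
Proof.
rewrite /is_intpart sort_sorted ?mem_sort ?mem_filter //=.
Qed.

(** Sorting makes the construction total; it is only used on lists that are
    already weakly decreasing. *)
Definition intpart_of_seq (s : seq nat) : intpart := IntPart (sort_filter_intpart s).

(** In a weakly decreasing list the zeros come last, so that deleting them does
    not move the other entries. *)
Lemma part_intpart_of_seq (s : seq nat) i :
  sorted geq s -> part (intpart_of_seq s) i = nth 0%N s i.
Proof.
have geq_tr : transitive geq by move=> a b c ab bc; apply: leq_trans bc ab.
move=> ss; rewrite /part /= sorted_sort ?sorted_filter //.
elim: s ss i => //= x s IHs xs i.
have ss := path_sorted xs.
have [x0|x0] /= := eqVneq x 0%N; last by case: i => //= i; exact: IHs.
rewrite IHs //; have s0 j : nth 0%N s j = 0%N.
  have [js|/(nth_default 0%N)//] := ltnP j (size s).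
  have /allP := order_path_min geq_tr xs; move=> /(_ _ (mem_nth 0%N js)) /=.
  by rewrite x0 leqn0 => /eqP.
by case: i => [|i] /=; rewrite s0.
Qed.

Definition intpart_of_ffun N n (f : {ffun 'I_N -> 'I_n.+1}) : intpart :=
  intpart_of_seq [seq val (f i) | i <- enum 'I_N].

Lemma size_intpart_of_ffun N n (f : {ffun 'I_N -> 'I_n.+1}) :
  (size (intpart_of_ffun f) <= N)%N.
Proof.
rewrite /= size_sort (leq_trans (size_subseq (filter_subseq _ _))) //.
by rewrite size_map size_enum_ord.
Qed.

Lemma part_intpart_of_ffun_le N n (f : {ffun 'I_N -> 'I_n.+1}) i :
  (part (intpart_of_ffun f) i <= n)%N.
Proof.
have [isz|szi] := ltnP i (size (intpart_of_ffun f)); last by rewrite part_default.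
have := mem_nth 0%N isz; rewrite /= mem_sort mem_filter => /andP[_ /mapP[j _]].
by rewrite /part => ->; rewrite -ltnS ltn_ord.
Qed.

Lemma part_intpart_of_ffun N n (f : {ffun 'I_N -> 'I_n.+1}) (i : 'I_N) :
  (forall i j : 'I_N, (i <= j)%N -> (f j <= f i)%N) ->
  part (intpart_of_ffun f) i = f i.
Proof.
move=> fdec; rewrite part_intpart_of_seq.
  by rewrite (nth_map i) ?size_enum_ord // nth_ord_enum.
have := iota_sorted 0 N; rewrite -val_enum_ord !sorted_map.
by apply: sub_sorted => a b /=; apply: fdec.
Qed.

Definition in_box N n (la : intpart) := (size la <= N)%N && (part la 0 <= n)%N.

(** Several functions f may give the same partition, whence the removal of
    duplicates. *)
Definition box N n : seq intpart :=
  undup [seq intpart_of_ffun f | f : {ffun 'I_N -> 'I_n.+1}].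

Lemma ffun_of_in_box N n la : in_box N n la ->
  la = intpart_of_ffun [ffun i : 'I_N => inord (part la i) : 'I_n.+1].
Proof.
move=> /andP[sN ln]; apply: intpart_ext => i.
have fE (j : 'I_N) : [ffun i : 'I_N => inord (part la i) : 'I_n.+1] j = part la j :> nat.
  by rewrite ffunE inordK // ltnS (leq_trans _ ln) // part_geq.
have [iN|Ni] := ltnP i N.
  rewrite -[i]/(val (Ordinal iN)) part_intpart_of_ffun ?fE // => j k jk.
  by rewrite !fE part_geq.
by rewrite (part_default (leq_trans sN Ni)) part_default // (leq_trans _ Ni) // size_intpart_of_ffun.
Qed.

Lemma mem_box N n la : (la \in box N n) = in_box N n la.
Proof.
rewrite mem_undup; apply/idP/idP => [/mapP[f _ ->]|/ffun_of_in_box->].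
  by rewrite /in_box size_intpart_of_ffun part_intpart_of_ffun_le.
by apply: map_f; rewrite mem_enum.
Qed.

Lemma box_uniq N n : uniq (box N n).
Proof. exact: undup_uniq. Qed.

Lemma noninc_leq (nu : nat -> nat) : (forall i, (nu i.+1 <= nu i)%N) ->
  forall i j, (i <= j)%N -> (nu j <= nu i)%N.
Proof.
move=> nu_dec i j /subnK <-; elim: (j - i)%N => [|m IH]; rewrite ?add0n //.
by rewrite (leq_trans (nu_dec _)).
Qed.

(** Any choice of f_i in the successive intervals [nu_(i+1), nu_i] is automatically
    weakly decreasing: the intervals meet only at their end points. *)
Lemma strip_family_noninc N n (nu : nat -> nat) (f : {ffun 'I_N -> 'I_n.+1}) :
  (forall i, (nu i.+1 <= nu i)%N) ->
  f \in family (fun (i : 'I_N) (k : 'I_n.+1) => (nu i.+1 <= k <= nu i)%N) ->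
  forall i j : 'I_N, (i <= j)%N -> (f j <= f i)%N.
Proof.
move=> nu_dec /familyP fF i j; rewrite leq_eqVlt => /orP[/eqP/val_inj->//|ij].
have /andP[_ fj] := fF j; have /andP[fi _] := fF i.
by rewrite (leq_trans fj) // (leq_trans _ fi) // noninc_leq.
Qed.

(** Partitions interlacing with nu are parametrized by independent choices of
    their parts, one in each interval [nu_(i+1), nu_i]; this is what makes sums of
    determinants over them factor. *)
Lemma box_strips (R : nmodType) N n (nu : nat -> nat) (Q : pred intpart)
    (phi : intpart -> R) :
  (forall i, (nu i.+1 <= nu i)%N) -> (nu 0 <= n)%N ->
  (forall la, in_box N n la ->
     Q la = [forall i : 'I_N, (nu i.+1 <= part la i <= nu i)%N]) ->
  \sum_(la <- box N n | Q la) phi la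
  = \sum_(f in family (fun (i : 'I_N) (k : 'I_n.+1) => (nu i.+1 <= k <= nu i)%N))
      phi (intpart_of_ffun f).
Proof.
move=> nu_dec nu_n QE.
have nu_mono := noninc_leq nu_dec.
set F := family _.
have Fdec f : f \in F -> forall i j : 'I_N, (i <= j)%N -> (f j <= f i)%N.
  exact: strip_family_noninc.
rewrite -big_filter -[RHS]big_enum -[RHS](big_map (@intpart_of_ffun N n) xpredT phi).
apply: perm_big; apply: uniq_perm.
- by rewrite filter_uniq // box_uniq.
- rewrite map_inj_in_uniq ?enum_uniq // => f g; rewrite !mem_enum => fF gF fg.
  apply/ffunP => i; apply: val_inj.
  by rewrite /= -!part_intpart_of_ffun ?fg //; apply: Fdec.
move=> la; rewrite mem_filter mem_box.
apply/andP/mapP => [[Qla bla]|[f]].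
  exists [ffun i : 'I_N => inord (part la i) : 'I_n.+1]; last exact: ffun_of_in_box.
  have /forallP stripla : [forall i : 'I_N, (nu i.+1 <= part la i <= nu i)%N].
    by rewrite -QE.
  rewrite mem_enum; apply/familyP => i; rewrite unfold_in /= ffunE inordK //.
  have /andP[_ lai] := stripla i.
  by rewrite ltnS (leq_trans lai) // (leq_trans _ nu_n) // nu_mono.
rewrite mem_enum => fF ->.
have bf : in_box N n (intpart_of_ffun f).
  by rewrite /in_box size_intpart_of_ffun part_intpart_of_ffun_le.
split=> //; rewrite QE //; apply/forallP => i.
by rewrite part_intpart_of_ffun; [exact: (familyP fF)|exact: Fdec].
Qed.

(** * Determinants with adjacent rows or columns combined *)

Lemma det_scale (R : comNzRingType) N (a b : 'I_N -> R) (A : 'M[R]_N) :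
  \det (\matrix_(i, j) (a i * A i j * b j))
  = (\prod_i a i) * \det A * (\prod_j b j).
Proof.
have -> : \matrix_(i, j) (a i * A i j * b j)
          = diag_mx (\row_i a i) *m A *m diag_mx (\row_j b j).
  by apply/matrixP => i j; rewrite mul_diag_mx mul_mx_diag !mxE.
rewrite !det_mulmx !det_diag.
by congr (_ * _ * _); apply: eq_bigr => i _; rewrite !mxE.
Qed.

(** Adding to each row a multiple of the next one is multiplication by an upper
    triangular matrix.  The hypothesis discards row N, which lies outside the
    matrix. *)
Lemma det_next_rows (R : comNzRingType) N (a b : nat -> R)
    (B : nat -> nat -> R) :
  (forall j, (j < N)%N -> b N.-1 * B N j = 0) ->
  \det (\matrix_(i < N, j < N) (a i * B i j + b i * B i.+1 j))
  = (\prod_(i < N) a i) * \det (\matrix_(i < N, j < N) B i j).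
Proof.
move=> bB0.
pose U : 'M[R]_N :=
  \matrix_(i, k) (a i *+ (k == i) + b i *+ (k == i.+1 :> nat)).
have -> : \matrix_(i < N, j < N) (a i * B i j + b i * B i.+1 j)
          = U *m \matrix_(i < N, j < N) B i j.
  apply/matrixP => i j; rewrite !mxE.
  under eq_bigr => k _ do rewrite !mxE mulrDl !mulrnAl.
  rewrite big_split /=.
  under eq_bigr => k _ do rewrite mulrb.
  under [X in _ = _ + X]eq_bigr => k _ do rewrite mulrb.
  rewrite -!big_mkcond big_pred1_eq; congr (_ + _).
  have [iN|] := ltnP i.+1 N.
    by rewrite (big_pred1 (Ordinal iN)) // => k; rewrite -val_eqE.
  rewrite leq_eqVlt ltnNge ltn_ord orbF => /eqP Ni.
  rewrite big1 => [|k /eqP ki]; last by have := ltn_ord k; lia.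
  by rewrite -Ni -[X in b X]/(i.+1.-1) -Ni bB0.
rewrite det_mulmx; congr (_ * _).
rewrite -det_tr det_trig; last first.
  apply/is_trig_mxP => i j ij; rewrite !mxE -val_eqE.
  have -> : (i == j :> nat) = false by lia.
  have -> : (i == j.+1 :> nat) = false by lia.
  by rewrite !mulr0n addr0.
apply: eq_bigr => i _; rewrite !mxE eqxx.
have -> : (i == i.+1 :> nat) = false by lia.
by rewrite addr0.
Qed.

Lemma det_next_cols (R : comNzRingType) N (a b : nat -> R)
    (B : nat -> nat -> R) :
  (forall i, (i < N)%N -> b N.-1 * B i N = 0) ->
  \det (\matrix_(i < N, j < N) (a j * B i j + b j * B i j.+1))
  = (\prod_(j < N) a j) * \det (\matrix_(i < N, j < N) B i j).
Proof.
move=> bB0.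
rewrite -[LHS]det_tr -[X in _ = _ * X]det_tr.
rewrite (_ : (\matrix_(i, j) B i j)^T = \matrix_(i < N, j < N) B j i).
  rewrite -(@det_next_rows _ N a b (fun j i => B i j)) //.
  by congr (\det _); apply/matrixP => i j; rewrite !mxE.
by apply/matrixP => i j; rewrite !mxE.
Qed.

(** Multilinearity of the determinant in all its rows at once. *)
Lemma sum_det_rows (R : comNzRingType) N (J : finType) (Q : 'I_N -> pred J)
    (A : 'I_N -> J -> 'I_N -> R) :
  \sum_(f in family Q) \det (\matrix_(i, j) A i (f i) j)
  = \det (\matrix_(i, j) \sum_(k | Q i k) A i k j).
Proof.
rewrite /determinant exchange_big /=; apply: eq_bigr => s _.
rewrite -mulr_sumr; congr (_ * _).
under [RHS]eq_bigr => i _ do rewrite mxE.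
rewrite bigA_distr_big_dep; apply: eq_bigr => f _.
by apply: eq_bigr => i _; rewrite mxE.
Qed.

(** The complete homogeneous symmetric function h_k at (1, t, t^2, ...). *)
Definition homog (R : fieldType) (t : R) (k : nat) : R :=
  \prod_(i < k) (1 - t ^+ i.+1)^-1.

(** This is h_(l - i + j), with the convention that h vanishes at negative
    indices. *)
Definition jt_entry (R : nmodType) (h : nat -> R) (l i j : nat) : R :=
  if (i <= l + j)%N then h (l + j - i)%N else 0.

Definition jt_mx (R : nmodType) (h : nat -> R) N (l : nat -> nat) : 'M[R]_N :=
  \matrix_(i, j) jt_entry h (l i) i j.

Lemma jt_mx_last0 (R : comNzRingType) (h : nat -> R) N l :
  h 0%N = 1 -> l N = 0%N -> \det (jt_mx h N.+1 l) = \det (jt_mx h N l).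
Proof.
move=> h0 lN; rewrite (expand_det_row _ ord_max) big_ord_recr /= big1.
  rewrite add0r mxE /= /jt_entry lN add0n leqnn subnn h0 mul1r /cofactor.
  rewrite -signr_odd oddD addbb mul1r; congr (\det _).
  apply/matrixP => i j; rewrite !mxE.
  by rewrite !lift_max.
by move=> j _; rewrite mxE /jt_entry /= lN add0n leqNgt ltn_ord mul0r.
Qed.

Lemma homogS (R : fieldType) (t : R) k :
  1 - t ^+ k.+1 != 0 -> (1 - t ^+ k.+1) * homog t k.+1 = homog t k.
Proof. by move=> nz; rewrite /homog big_ord_recr /= mulrCA divff // mulr1. Qed.

(** With L = l_i + N - 1 - i and k = N - 1 - j, the entry (i, j) is h_(L - k), and
    (1 - t^L) h_(L-k) = (1 - t^k) h_(L-k) + t^k h_(L-k-1).  So multiplying row i by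
    1 - t^L amounts to combining adjacent columns of the matrix for the
    parts l_i - 1; the last column needs no neighbour since k = 0 there. *)
Lemma jt_mx_shift (R : fieldType) (t : R) N (l : nat -> nat) :
  (forall k, 1 - t ^+ k.+1 != 0) -> (forall i, (i < N)%N -> (0 < l i)%N) ->
  (\prod_(i < N) (1 - t ^+ (l i + N - i - 1))) * \det (jt_mx (homog t) N l)
  = (\prod_(j < N) t ^+ (N - 1 - j)) *
    \det (jt_mx (homog t) N (fun i => (l i).-1)).
Proof.
move=> nz l0; set h := homog t.
have hS k : h k = (1 - t ^+ k.+1) * h k.+1 by rewrite /h homogS.
pose B i j := if (i <= (l i).-1 + j)%N then h ((l i).-1 + j - i)%N else 0.
have := @det_next_cols R N (fun j => t ^+ (N - 1 - j))
  (fun j => 1 - t ^+ (N - 1 - j)) B.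
move=> /= <-; last by move=> i iN; rewrite subn1 subnn expr0 subrr mul0r.
have := @det_scale R N (fun i => 1 - t ^+ (l i + N - i - 1)) (fun=> 1) (jt_mx h N l).
rewrite [X in _ * _ * X]big1 // mulr1 => <-; congr (\det _).
apply/matrixP => i j; rewrite !mxE mulr1.
have li := l0 i (ltn_ord i); have iN := ltn_ord i; have jN := ltn_ord j.
have lj : ((l i).-1 + j.+1 = l i + j)%N by lia.
rewrite /B /jt_entry lj.
case: leqP => [ilj|lji]; last first.
  by rewrite ifF ?mulr0 ?addr0 //; lia.
rewrite (_ : l i + N - i - 1 = (N - 1 - j) + (l i + j - i))%N; last by lia.
rewrite exprD; case: leqP => ilj'.
  rewrite (_ : l i + j - i = ((l i).-1 + j - i).+1)%N; last by lia.
  by rewrite (hS ((l i).-1 + j - i)%N); ring.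
have -> : (l i + j - i = 0)%N by lia.
by rewrite expr0; ring.
Qed.

Definition psum (R : pzSemiRingType) (h : nat -> R) (z : R) (k : nat) : R :=
  \sum_(m < k) z ^+ m * h m.

Lemma psumB (R : fieldType) (h : nat -> R) (z : R) (l i j : nat) : z != 0 ->
  psum h z (l + j.+1 - i) - psum h z (l + j - i)
  = z ^+ l * (z ^- i * jt_entry h l i j * z ^+ j).
Proof.
move=> z0; rewrite /jt_entry; case: leqP => [ilj|lji].
  rewrite addnS subSn // /psum big_ord_recr /= [X in X - _]addrC addrK.
  rewrite -[in LHS](mulfK (expf_neq0 i z0) (z ^+ _)) -exprD subnK // exprD.
  by ring.
have -> : (l + j - i = 0)%N by lia.
have -> : (l + j.+1 - i = 0)%N by lia.
by rewrite mulr0 mul0r mulr0 subrr.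
Qed.

(** The powers of z are moved into the rows.  Then the sum over f_i of row i
    telescopes, by [psumB], into the difference of the rows i and i + 1 of the
    matrix on the right; its row N would be zero because nu_N = 0. *)
Lemma strip_det (R : fieldType) (h : nat -> R) (z : R) N n (nu : nat -> nat) :
  z != 0 -> (forall i, (nu i.+1 <= nu i)%N) -> (nu 0 <= n)%N -> nu N = 0%N ->
  \sum_(f in family (fun (i : 'I_N) (k : 'I_n.+1) => (nu i.+1 <= k <= nu i)%N))
     (\prod_i z ^+ f i) * \det (\matrix_(i, j) jt_entry h (f i) i j)
  = \det (\matrix_(i < N, j < N) psum h z (nu i + j.+1 - i)).
Proof.
move=> z0 nu_dec nu_n nuN.
pose A (i : 'I_N) (k : 'I_n.+1) (j : 'I_N) := z ^+ k * jt_entry h k i j.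
under eq_bigr => f _.
  have -> : (\prod_i z ^+ f i) * \det (\matrix_(i, j) jt_entry h (f i) i j)
            = \det (\matrix_(i, j) A i (f i) j).
    have := det_scale (fun i => z ^+ f i) (fun=> 1) (\matrix_(i, j) jt_entry h (f i) i j).
    rewrite [X in _ * _ * X]big1 // mulr1 => <-; congr (\det _).
    by apply/matrixP => i j; rewrite !mxE mulr1.
  over.
rewrite sum_det_rows.
pose B i j := psum h z (nu i + j.+1 - i).
have -> : \matrix_(i, j) \sum_(k : 'I_n.+1 | (nu i.+1 <= k <= nu i)%N) A i k j
  = \matrix_(i < N, j < N) (z ^+ i * (\matrix_(i, j) (B i j - B i.+1 j)) i j * z ^- j).
  apply/matrixP => i j; rewrite !mxE.
  rewrite -(big_mkord (fun k => (nu i.+1 <= k <= nu i)%N)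
             (fun k => z ^+ k * jt_entry h k i j)).
  have nu_i : (nu i <= nu 0)%N.
    by elim: (i : nat) => // m; apply: leq_trans.
  have -> : \sum_(0 <= k < n.+1 | (nu i.+1 <= k <= nu i)%N) z ^+ k * jt_entry h k i j
          = \sum_(nu i.+1 <= k < (nu i).+1) z ^+ k * jt_entry h k i j.
    rewrite [RHS](big_nat_widenl _ 0%N) // [RHS](big_nat_widen _ _ n.+1); last by lia.
    by apply: eq_bigl => k; rewrite !andTb ltnS.
  rewrite (@telescope_sumr_eq _ _ _
     (fun k => z ^+ i * psum h z (k + j - i) * z ^- j)).
  - have nuS : (nu i.+1 + j.+1 - i.+1 = nu i.+1 + j - i)%N by rewrite addnS subSS.
    by rewrite -mulrBl -mulrBr /B addSnnS nuS.
  - by have := nu_dec i; lia.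
  move=> k _; rewrite -mulrBl -mulrBr addSnnS psumB //.
  by rewrite 2!mulrA; field; rewrite !expf_neq0.
rewrite det_scale mulrAC -big_split /= big1 ?mul1r => [|i _]; last first.
  by rewrite divff // expf_neq0.
have := @det_next_rows _ N (fun=> 1) (fun=> -1) B.
rewrite [X in _ -> _ = X * _]big1 // mul1r => <-.
  by congr (\det _); apply/matrixP => i j; rewrite !mxE mul1r mulN1r.
move=> j jN; have jN0 : (j.+1 - N = 0)%N by lia.
by rewrite /B nuN add0n jN0 /psum big_ord0 mulr0.
Qed.

(** Subtracting adjacent columns turns all columns but the last back into terms
    z^k h_k.  The first row becomes (z^(n+j+1) h_(n+j+1), ..., psum (n+N+1)) and is
    the only one that depends on n, so that in the expansion along it the
    cofactors are constants, the last of them being the Jacobi-Trudi determinant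
    of mu up to a power of z. *)
Lemma pieri_det (R : fieldType) (h : nat -> R) (z : R) N (mu : nat -> nat) :
  z != 0 -> exists c : 'I_N -> R, forall n,
  \det (\matrix_(i < N.+1, j < N.+1)
           psum h z ((if i : nat is i'.+1 then mu i' else n) + j.+1 - i))
  = psum h z (n + N.+1) * ((\prod_(i < N) z ^+ mu i) * \det (jt_mx h N mu))
    + \sum_(j < N) z ^+ (n + j.+1) * h (n + j.+1)%N * c j.
Proof.
move=> z0.
pose nu n i := if i is i'.+1 then mu i' else n.
(* column j is replaced by column j + 1 minus column j, except the last one *)
pose a j : R := if (j < N)%N then -1 else 1.
pose b j : R := if (j < N)%N then 1 else 0.
pose B n i j := psum h z (nu n i + j.+1 - i).
pose M n := \matrix_(i < N.+1, j < N.+1) (a j * B n i j + b j * B n i j.+1).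
have detM n : \det (\matrix_(i < N.+1, j < N.+1) B n i j) = (-1) ^+ N * \det (M n).
  rewrite (@det_next_cols _ N.+1 a b (B n)) => [|i _].
    rewrite big_ord_recr /= /a ltnn mulr1 (eq_bigr (fun=> -1)) => [|i _].
      by rewrite prodr_const card_ord signrMK.
    by rewrite /= ltn_ord.
  by rewrite /b ltnn mul0r.
have ME n (i : 'I_N.+1) (j : 'I_N) : M n i (lift ord_max j)
    = z ^+ nu n i * (z ^- i * jt_entry h (nu n i) i j.+1 * z ^+ j.+1).
  by rewrite mxE lift_max /a /b ltn_ord -psumB // /B mulN1r mul1r addrC.
have cofM n j : cofactor (M n) ord0 j = cofactor (M 0%N) ord0 j.
  by congr (_ * \det _); apply/matrixP => i k; rewrite !mxE.
exists (fun j => (-1) ^+ N * cofactor (M 0%N) ord0 (lift ord_max j)) => n.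
rewrite detM (expand_det_row _ ord0) big_ord_recr /= addrC mulrDr; congr (_ + _).
  rewrite {1}/M mxE /= /a /b ltnn mul1r mul0r addr0 {1}/B /= subn0.
  rewrite mulrCA; congr (_ * _); rewrite /cofactor /= add0n signrMK.
  transitivity (\det (\matrix_(i < N, j < N)
    (z ^+ mu i * z ^- i * (jt_mx h N mu) i j * z ^+ j))).
    congr (\det _); apply/matrixP => i j.
    rewrite [in LHS]mxE [in LHS]mxE ME [in RHS]mxE [in RHS]mxE.
    rewrite /bump /= /jt_entry ?add1n addnS ltnS subSS !exprS.
    rewrite !add0n; set e := if _ then _ else _.
    by field; rewrite expf_neq0.
  rewrite det_scale mulrAC -big_split /=; congr (_ * _).
  by apply: eq_bigr => i _; rewrite mulfVK // expf_neq0.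
rewrite mulr_sumr; apply: eq_bigr => j _.
have -> : widen_ord (leqnSn N) j = lift ord_max j.
  by apply: val_inj; exact: esym (lift_max j).
rewrite ME cofM /= /jt_entry leq0n subn0 expr0 invr1 mul1r exprD.
by ring.
Qed.

(** * The Jacobi-Trudi formula at the principal specialization *)

(** The Schur function of la at (1, t, t^2, ...) with t = q^-1: by the hook formula
    its value is t^n(la) / prod_x (1 - t^h(x)), which has the form below because
    the hook lengths add up to n(la) + n(la') + |la|. *)
Definition principal (R : fieldType) (q : R) (la : intpart) : R :=
  q ^+ (n_conj la + part_size la) *
  \prod_(i < size la) \prod_(j < part la i) (q ^+ hook la i j - 1)^-1.

(** Empty rows contribute nothing, so the number of rows may be overestimated;
    this allows partitions with different numbers of parts to be compared. *)
Lemma big_rows (R : Type) (idx : R) (op : Monoid.com_law idx) (la : intpart) N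
    (F : nat -> R) :
  (size la <= N)%N -> (forall i, part la i = 0%N -> F i = idx) ->
  \big[op/idx]_(i < size la) F i = \big[op/idx]_(i < N) F i.
Proof.
move=> laN F0; rewrite (big_ord_widen _ F laN) big_mkcond.
apply: eq_bigr => i _; case: ltnP => // lai.
by rewrite F0 // part_default.
Qed.

Lemma part_size_rows (la : intpart) N :
  (size la <= N)%N -> part_size la = (\sum_(i < N) part la i)%N.
Proof.
move=> laN; rewrite -(big_rows (F := part la) _ laN) //.
by rewrite /part_size sumnE (big_nth 0%N) big_mkord.
Qed.

Lemma principal_rows (R : fieldType) (q : R) (la : intpart) N :
  (size la <= N)%N ->
  principal q la = \prod_(i < N)
    (q ^+ ((part la i * (part la i - 1)) %/ 2 + part la i) *
     \prod_(j < part la i) (q ^+ hook la i j - 1)^-1).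
Proof.
move=> laN; rewrite big_split /= /principal; congr (_ * _); last first.
  apply: (big_rows (F := fun i => \prod_(j < part la i) (q ^+ hook la i j - 1)^-1)
    _ laN) => i ->; by rewrite big_ord0.
rewrite -(big_rows (F := fun i => q ^+ ((part la i * (part la i - 1)) %/ 2 + part la i))
    _ laN) => [|i ->]; last by rewrite mul0n.
rewrite -expr_sum; congr (_ ^+ _).
by rewrite big_split /= /n_conj (part_size_rows (leqnn _)).
Qed.

Lemma principal0 (R : fieldType) (q : R) : principal q empty_intpart = 1.
Proof. by rewrite (principal_rows q (leqnn _)) big_ord0. Qed.

Definition del_col (la : intpart) : intpart := intpart_of_seq (map predn la).

Lemma part_del_col la i : part (del_col la) i = (part la i).-1.
Proof.
rewrite part_intpart_of_seq; last first.
  have /andP[sla _] := partsP la; rewrite sorted_map.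
  by apply: sub_sorted sla => a b /=; lia.
have [il|li] := ltnP i (size la); first by rewrite (nth_map 0%N).
by rewrite part_default // nth_default // size_map.
Qed.

Lemma size_del_col (la : intpart) : (size (del_col la) <= size la)%N.
Proof.
by rewrite /= size_sort (leq_trans (size_subseq (filter_subseq _ _))) ?size_map.
Qed.

Lemma conj_part_del_col la j : conj_part (del_col la) j = conj_part la j.+1.
Proof.
rewrite /conj_part /= count_sort count_filter count_map.
by apply: eq_count => p /=; apply/andP/idP => [[]|]; lia.
Qed.

Lemma hook_del_col la i j : (0 < part la i)%N ->
  hook (del_col la) i j = hook la i j.+1.
Proof. by rewrite /hook part_del_col conj_part_del_col => lai; lia. Qed.

Lemma hook_col0 (la : intpart) i : hook la i 0 = (part la i + size la - i - 1)%N.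
Proof.
rewrite /hook /conj_part subn0; congr (_ + _ - _ - _)%N.
apply/eqP; rewrite -all_count; apply/allP => p pla; rewrite lt0n.
by apply: contraTneq pla => ->; have /andP[] := partsP la.
Qed.

(** The boxes outside the first column keep their hook lengths when that column is
    deleted, and the first box of row i has hook length la_i + size la - 1 - i.
    The identity then holds row by row. *)
Lemma principal_del_col (R : fieldType) (q : R) (la : intpart) :
  q != 0 -> (forall k, q ^+ k.+1 - 1 != 0) ->
  (\prod_(i < size la) (1 - q^-1 ^+ (part la i + size la - i - 1))) * principal q la
  = (\prod_(i < size la) q^-1 ^+ (size la - 1 - i)) * principal q (del_col la).
Proof.
move=> q0 q1; rewrite (principal_rows q (leqnn _)).
rewrite (principal_rows q (size_del_col la)) -!big_split /=.
apply: eq_bigr => i _; rewrite part_del_col.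
have lai : (0 < part la i)%N by rewrite intpart_gt0.
under [X in _ = _ * (_ * X)]eq_bigr => j _ do rewrite hook_del_col //.
case: (part la i) (hook_col0 la i) lai => // k hk _.
rewrite big_ord_recl /= hk; set P := \prod_(j < k) _.
have il := ltn_ord i.
set m := (size la - 1 - i)%N.
have -> : (k.+1 + size la - i - 1 = k.+1 + m)%N by lia.
have -> : (k.+1 * (k.+1 - 1) %/ 2 + k.+1 = k * (k - 1) %/ 2 + k + k.+1)%N.
  have -> : (k.+1 * (k.+1 - 1) = k * 2 + k * (k - 1))%N by rewrite !subn1; case: (k) => // n /=; nia.
  by rewrite divnMDl //; lia.
rewrite !exprVn [q ^+ (k * _ %/ 2 + k + _)]exprD [q ^+ (_ + m)]exprD.
have : q ^+ (k.+1 + m) - 1 != 0 by rewrite addSn q1.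
rewrite exprD.
move: (q ^+ k.+1) (q ^+ m) (expf_neq0 k.+1 q0) (expf_neq0 m q0) => x y x0 y0 xy.
move: (q ^+ (_ + _)) => w.
by field; rewrite x0 y0 xy.
Qed.

Lemma one_subVX_neq0 (R : fieldType) (q : R) k :
  q ^+ k - 1 != 0 -> 1 - q^-1 ^+ k != 0.
Proof.
apply: contraNneq => /eqP; rewrite exprVn subr_eq0 => /eqP qk.
by rewrite -[q ^+ _]invrK -qk invr1 subrr.
Qed.

(** The Jacobi-Trudi formula.  Rows of length zero do not change the determinant,
    and deleting the first column changes both sides by the same factor. *)
Lemma det_jt_principal (R : fieldType) (q : R) (la : intpart) N :
  q != 0 -> (forall k, q ^+ k.+1 - 1 != 0) -> (size la <= N)%N ->
  \det (jt_mx (homog q^-1) N (part la)) = principal q la.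
Proof.
move=> q0 q1.
have t1 k : 1 - q^-1 ^+ k.+1 != 0 by rewrite one_subVX_neq0.
have [m] := ubnP (part_size la); elim: m la N => // m IHm la N lam laN.
have -> : \det (jt_mx (homog q^-1) N (part la))
        = \det (jt_mx (homog q^-1) (size la) (part la)).
  rewrite -(subnK laN); elim: (N - size la)%N => // k IHk.
  rewrite addSn jt_mx_last0 ?IHk //; first by rewrite /homog big_ord0.
  by rewrite part_default // leq_addl.
have [la0|la0] := posnP (size la).
  rewrite (principal_rows q (leqnn _)) la0 big_ord0.
  exact: det_mx00.
have lai i : (i < size la)%N -> (0 < part la i)%N by rewrite intpart_gt0.
have := jt_mx_shift t1 lai.
have -> : jt_mx (homog q^-1) (size la) (fun i => (part la i).-1)
        = jt_mx (homog q^-1) (size la) (part (del_col la)).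
  by apply/matrixP => i j; rewrite !mxE part_del_col.
rewrite (IHm (del_col la)) ?size_del_col //; last first.
  apply: (@leq_trans (part_size la)); last exact: lam.
  rewrite (part_size_rows (size_del_col la)).
  rewrite (part_size_rows (leqnn (size la))).
  rewrite (eq_bigr (fun i : 'I_(size la) => (part la i).-1)); last first.
    by move=> i _; rewrite part_del_col.
  rewrite (bigD1 (Ordinal la0)) //= [X in (_ < X)%N](bigD1 (Ordinal la0)) //=.
  rewrite -addSn prednK ?lai // leq_add2l.
  by apply: leq_sum => i _; exact: leq_pred.
rewrite -principal_del_col //; apply: mulfI.
apply/prodf_neq0 => i _.
rewrite (_ : _ - _ = (part la i + size la - i - 2).+1)%N ?t1 //.
by have := ltn_ord i; have := lai _ (ltn_ord i); lia.
Qed.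

(** * Branching and Pieri rules *)

Lemma strip_sum (R : fieldType) (q z : R) N n (nu : nat -> nat) (Q : pred intpart) :
  q != 0 -> (forall k, q ^+ k.+1 - 1 != 0) -> z != 0 ->
  (forall i, (nu i.+1 <= nu i)%N) -> (nu 0 <= n)%N -> nu N = 0%N ->
  (forall la, in_box N n la ->
     Q la = [forall i : 'I_N, (nu i.+1 <= part la i <= nu i)%N]) ->
  \sum_(la <- box N n | Q la) z ^+ part_size la * principal q la
  = \det (\matrix_(i < N, j < N) psum (homog q^-1) z (nu i + j.+1 - i)).
Proof.
move=> q0 q1 z0 nu_dec nu_n nuN QE; rewrite (box_strips _ nu_dec nu_n QE).
rewrite -(strip_det _ z0 nu_dec nu_n nuN); apply: eq_bigr => f fF.
have fdec := strip_family_noninc nu_dec fF.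
rewrite -(det_jt_principal q0 q1 (size_intpart_of_ffun f)).
rewrite (part_size_rows (size_intpart_of_ffun f)) expr_sum.
congr (_ * _); first by apply: eq_bigr => i _; rewrite part_intpart_of_ffun.
congr (\det _).
by apply/matrixP => i j; rewrite !mxE part_intpart_of_ffun.
Qed.

(** The skew diagram la / mu is a horizontal strip. *)
Definition interlace (mu la : intpart) : bool :=
  `[< forall i, (part la i.+1 <= part mu i <= part la i)%N >].

Lemma psum_homog (R : fieldType) (t : R) k :
  (forall k, 1 - t ^+ k.+1 != 0) -> psum (homog t) t k.+1 = homog t k.
Proof.
move=> t1; rewrite /psum; elim: k => [|k IHk].
  by rewrite big_ord_recr big_ord0 /= expr0 mul1r add0r.
by rewrite big_ord_recr /= IHk -(homogS (t1 k)); ring.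
Qed.

(** Here z = t, for which the partial sums of H are again the h_k, so that the
    determinant of [strip_det] is the Jacobi-Trudi determinant of la. *)
Lemma branching (R : fieldType) (q : R) N n (la : intpart) :
  q != 0 -> (forall k, q ^+ k.+1 - 1 != 0) -> in_box N n la ->
  \sum_(mu <- box N n | interlace mu la) q^-1 ^+ part_size mu * principal q mu
  = principal q la.
Proof.
move=> q0 q1 /andP[laN lan].
have t1 k : 1 - q^-1 ^+ k.+1 != 0 by rewrite one_subVX_neq0.
rewrite (strip_sum (nu := part la)) ?invr_eq0 //.
- rewrite -(det_jt_principal q0 q1 laN); congr (\det _).
  apply/matrixP => i j; rewrite !mxE /jt_entry; case: leqP => ij.
    by rewrite addnS subSn // psum_homog.
  have -> : (part la i + j.+1 - i = 0)%N by lia.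
  by rewrite /psum big_ord0.
- by move=> i; rewrite part_geq.
- exact: part_default.
move=> mu /andP[muN _]; apply/asboolP/forallP => [lamu i|lamu i]; first exact: lamu.
have [iN|Ni] := ltnP i N; first exact: lamu (Ordinal iN).
by rewrite !part_default // ?(leq_trans laN) ?(leq_trans muN) // ltnW.
Qed.

(** The partitions la interlacing with mu from above have mu_i <= la_i <= mu_(i-1),
    where the bound on la_0 is n.  The last sum is the error caused by this
    truncation; it tends to 0 with n. *)
Lemma pieri (R : fieldType) (q z : R) N n0 (mu : intpart) :
  q != 0 -> (forall k, q ^+ k.+1 - 1 != 0) -> z != 0 -> in_box N n0 mu ->
  exists c : 'I_N -> R, forall n, (n0 <= n)%N ->
  \sum_(la <- box N.+1 n | interlace mu la) z ^+ part_size la * principal q la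
  = psum (homog q^-1) z (n + N.+1) * (z ^+ part_size mu * principal q mu)
    + \sum_(j < N) z ^+ (n + j.+1) * homog q^-1 (n + j.+1)%N * c j.
Proof.
move=> q0 q1 z0 /andP[muN mun0].
have [c cE] := pieri_det (homog q^-1) N (part mu) z0.
exists c => n n0n.
rewrite (det_jt_principal q0 q1 muN) -expr_sum -(part_size_rows muN) in cE.
rewrite -cE (strip_sum (nu := fun i => if i is i'.+1 then part mu i' else n)) //.
- by case=> [|i]; rewrite ?part_geq // (leq_trans mun0).
- exact: part_default.
move=> la /andP[laN lan]; apply/asboolP/forallP => [lamu i|lamu i].
  have /andP[_ lam] := lamu i; rewrite lam /=.
  by case: (i : nat) => // i'; have /andP[] := lamu i'.
have [iN|Ni] := ltnP i N.
  have /andP[_ /= lai] := lamu (Ordinal (iN : (i.+1 < N.+1)%N)).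
  by have /andP[/= mui _] := lamu (Ordinal (leqW iN)); rewrite lai mui.
by rewrite (part_default (leq_trans muN Ni)) (part_default (leq_trans laN _)).
Qed.

(** * The generating series of the h_k *)

Lemma geom_sum_le (R : realType) (s : R) n : 0 <= s -> s < 1 ->
  \sum_(i < n) s ^+ i <= (1 - s)^-1.
Proof.
move=> s0 s1; have s1' : 0 < 1 - s by rewrite subr_gt0.
rewrite -[leRHS]mul1r ler_pdivlMr // mulrC.
have := subrX1 s n; rewrite -opprB -[s - 1]opprB mulNr => /oppr_inj <-.
by rewrite lerBlDr lerDl exprn_ge0.
Qed.

(** This bound, uniform in n, serves both for the h_k and for the products of the
    H(u t^k). *)
Lemma prod_geom_le_expR (R : realType) (a s : R) n : 0 <= a -> 0 <= s -> s < 1 ->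
  \prod_(i < n) (1 + a * s ^+ i) <= expR (a / (1 - s)).
Proof.
move=> a0 s0 s1; apply: (@le_trans _ _ (\prod_(i < n) expR (a * s ^+ i))).
  apply: ler_prod => i _; rewrite expR_ge1Dx andbT.
  by rewrite addr_ge0 // mulr_ge0 // exprn_ge0.
by rewrite -expR_sum ler_expR -mulr_sumr ler_wpM2l // geom_sum_le.
Qed.

Lemma exp_lt1 (R : realType) (t : R) k : 0 < t -> t < 1 -> t ^+ k.+1 < 1.
Proof. by move=> t0 t1; rewrite exprn_ilt1 // ltW. Qed.

Lemma homog_gt0 (R : realType) (t : R) k : 0 < t -> t < 1 -> 0 < homog t k.
Proof.
by move=> t0 t1; apply: prodr_gt0 => i _; rewrite invr_gt0 subr_gt0 exp_lt1.
Qed.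

Lemma homog_le (R : realType) (t : R) k : 0 < t -> t < 1 ->
  homog t k <= expR (t / (1 - t) / (1 - t)).
Proof.
move=> t0 t1; have t1' : 0 < 1 - t by rewrite subr_gt0.
apply: le_trans (prod_geom_le_expR k _ (ltW t0) t1); last first.
  by rewrite divr_ge0 // ltW.
apply: ler_prod => i _; have ti : 0 < 1 - t ^+ i.+1 by rewrite subr_gt0 exp_lt1.
rewrite invr_ge0 (ltW ti) /= -[leLHS]mul1r ler_pdivrMr //.
have tit : t ^+ i.+1 <= t by rewrite exprS ler_piMr // ?exprn_ile1 // ltW.
have -> : t / (1 - t) * t ^+ i = t ^+ i.+1 / (1 - t) by rewrite exprS; ring.
have -> : (1 + t ^+ i.+1 / (1 - t)) * (1 - t ^+ i.+1)
        = 1 + t ^+ i.+1 * (t - t ^+ i.+1) / (1 - t).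
  by field; rewrite gt_eqF.
by rewrite lerDl divr_ge0 ?(ltW t1') // mulr_ge0 ?subr_ge0 // exprn_ge0 // ltW.
Qed.

Definition hsum (R : realType) (t z : R) : R := limn (psum (homog t) z).

Lemma psum_nondecreasing (R : realType) (h : nat -> R) (z : R) :
  (forall k, 0 <= h k) -> 0 <= z -> nondecreasing_seq (psum h z).
Proof.
move=> h0 z0; apply/nondecreasing_seqP => n.
by rewrite /psum big_ord_recr /= lerDl mulr_ge0 // exprn_ge0.
Qed.

Lemma psum_cvg (R : realType) (t z : R) : 0 < t -> t < 1 -> 0 <= z -> z < 1 ->
  psum (homog t) z @ \oo --> hsum t z.
Proof.
move=> t0 t1 z0 z1.
apply: nondecreasing_is_cvgn.
  by apply: psum_nondecreasing => // k; rewrite ltW // homog_gt0.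
exists (expR (t / (1 - t) / (1 - t)) * (1 - z)^-1) => _ [n _ <-].
apply: (@le_trans _ _ (\sum_(i < n) expR (t / (1 - t) / (1 - t)) * z ^+ i)).
  by apply: ler_sum => i _; rewrite mulrC ler_wpM2r ?exprn_ge0 // homog_le.
by rewrite -mulr_sumr ler_wpM2l ?expR_ge0 // geom_sum_le.
Qed.

Lemma psum_le_hsum (R : realType) (t z : R) k : 0 < t -> t < 1 -> 0 <= z -> z < 1 ->
  psum (homog t) z k <= hsum t z.
Proof.
move=> t0 t1 z0 z1; apply: nondecreasing_cvgn_le.
  by apply: psum_nondecreasing => // j; rewrite ltW // homog_gt0.
by apply: cvgP; exact: psum_cvg.
Qed.

Lemma hsum_ge1 (R : realType) (t z : R) : 0 < t -> t < 1 -> 0 <= z -> z < 1 ->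
  1 <= hsum t z.
Proof.
move=> t0 t1 z0 z1; apply: le_trans (psum_le_hsum 1 t0 t1 z0 z1).
by rewrite /psum big_ord1 expr0 mul1r /homog big_ord0.
Qed.

(** Since h_k - h_(k-1) = t^k h_k, the identity already holds between partial
    sums. *)
Lemma hsum_shift (R : realType) (t z : R) : 0 < t -> t < 1 -> 0 <= z -> z < 1 ->
  (1 - z) * hsum t z = hsum t (z * t).
Proof.
move=> t0 t1 z0 z1.
(* the truncated identity, with one more term in the first and last sums *)
have psumS k : psum (homog t) z k.+1 - z * psum (homog t) z k
             = psum (homog t) (z * t) k.+1.
  rewrite /psum; elim: k => [|k IHk]; first by rewrite !big_ord1 big_ord0 !expr0; ring.
  rewrite big_ord_recr [in RHS]big_ord_recr [X in _ - z * X]big_ord_recr /= -IHk.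
  have := @homogS _ t k; rewrite gt_eqF ?subr_gt0 ?exp_lt1 // => /(_ isT) <-.
  by rewrite exprMn [z ^+ k.+1]exprS; ring.
apply/esym/cvg_lim => //.
have zt1 : z * t < 1 by rewrite mulr_ilt1 // ltW.
have cz := psum_cvg t0 t1 z0 z1.
rewrite -cvg_shiftS /=; under eq_fun do rewrite -psumS.
rewrite mulrBl mul1r; apply: cvgB; first by rewrite cvg_shiftS.
by apply: cvgM => //; exact: cvg_cst.
Qed.

Lemma psum_scale (R : realType) (h : nat -> R) (s z : R) k :
  (forall j, 0 <= h j) -> h 0%N = 1 -> 0 <= z -> 0 <= s -> s <= 1 ->
  psum h (z * s) k <= 1 + s * psum h z k.
Proof.
move=> h0 h1 z0 s0 s1.
case: k => [|k]; first by rewrite /psum !big_ord0 mulr0 addr0.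
rewrite /psum !big_ord_recl /= !expr0 !mul1r h1 lerD2l mulrDr mulr_sumr.
rewrite ler_wpDl ?mulr1 // ler_sum // => i _.
rewrite [leRHS]mulrA ler_wpM2r // exprMn mulrC ler_wpM2r ?exprn_ge0 //.
by rewrite exprS ler_piMr // exprn_ile1.
Qed.

(** Coefficients are nonnegative and the constant term is 1. *)
Lemma hsum_scale (R : realType) (t s z : R) : 0 < t -> t < 1 -> 0 <= z -> z < 1 ->
  0 <= s -> s <= 1 -> hsum t (z * s) <= 1 + s * hsum t z.
Proof.
move=> t0 t1 z0 z1 s0 s1.
have zs1 : z * s < 1 by apply: le_lt_trans z1; rewrite ler_piMr.
have zs0 : 0 <= z * s by rewrite mulr_ge0.
apply: limr_le; first by apply: cvgP; exact: psum_cvg.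
near=> k; rewrite (@le_trans _ _ (1 + s * psum (homog t) z k)) //.
  by rewrite psum_scale // => [j|]; rewrite ?[homog _ 0]big_ord0 // ltW // homog_gt0.
by rewrite lerD2l ler_wpM2l // psum_le_hsum.
Unshelve. all: by end_near.
Qed.

(** Passing from K to K + 1 multiplies H(u t^K)^K by H(u t^K) (1 - u t^K)^(K+1), and
    (1 - z) H(z) = H(z t). *)
Lemma prod_hsum (R : realType) (t u : R) K : 0 < t -> t < 1 -> 0 <= u -> u < 1 ->
  (\prod_(k < K) hsum t (u * t ^+ k)) * (\prod_(k < K) (1 - u * t ^+ k) ^+ k.+1)
  = hsum t (u * t ^+ K) ^+ K.
Proof.
move=> t0 t1 u0 u1; elim: K => [|K IHK]; first by rewrite !big_ord0 mulr1.
rewrite !big_ord_recr /= mulrACA IHK mulrA -exprSr -exprMn mulrC.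
rewrite hsum_shift ?mulr_ge0 ?exprn_ge0 ?(ltW t0) //; first by rewrite [t ^+ K.+1]exprSr mulrA.
by apply: le_lt_trans u1; rewrite ler_piMr // exprn_ile1 // ltW.
Qed.

(** With s the square root of t, K s^K is at most 1 + s + ... + s^(K-1), hence
    bounded, and t^K = s^K s^K. *)
Lemma cvg_natX_geom (R : realType) (t : R) : 0 < t -> t < 1 ->
  (fun K => K%:R * t ^+ K) @ \oo --> (0 : R).
Proof.
move=> t0 t1; pose s := Num.sqrt t.
have st : s ^+ 2 = t by rewrite sqr_sqrtr // ltW.
have s0 : 0 < s by rewrite sqrtr_gt0.
have s1 : s < 1 by rewrite -(expr_lt1 (n := 2)) ?st // ltW.
apply: (@squeeze_cvgr _ _ _ _ (fun=> 0) (fun K => (1 - s)^-1 * s ^+ K)).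
- near=> K; rewrite mulr_ge0 ?exprn_ge0 ?(ltW t0) //=.
  have -> : t ^+ K = s ^+ K * s ^+ K by rewrite -exprD addnn -mul2n exprM st.
  rewrite mulrA ler_wpM2r ?exprn_ge0 ?(ltW s0) //.
  apply: le_trans (geom_sum_le K (ltW s0) s1).
  rewrite mulr_natl -[K in _ *+ K]card_ord -sumr_const ler_sum // => i _.
  by rewrite ler_wiXn2l ?(ltW s0) ?(ltW s1) // ltnW.
- exact: cvg_cst.
by apply: cvg_geometric; rewrite ger0_norm ?ltW.
Unshelve. all: by end_near.
Qed.

Lemma hsum_pow_cvg (R : realType) (t u : R) : 0 < t -> t < 1 -> 0 <= u -> u < 1 ->
  (fun K => hsum t (u * t ^+ K) ^+ K) @ \oo --> (1 : R).
Proof.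
move=> t0 t1 u0 u1.
have tK K : 0 <= t ^+ K <= 1 by rewrite exprn_ge0 ?exprn_ile1 // ltW.
have utK K : 0 <= u * t ^+ K < 1.
  have /andP[tK0 tK1] := tK K; rewrite mulr_ge0 //=.
  by apply: le_lt_trans u1; rewrite ler_piMr.
apply: (@squeeze_cvgr _ _ _ _ (fun=> 1)
  (fun K => expR (K%:R * t ^+ K * hsum t u))).
- near=> K; have /andP[tK0 tK1] := tK K; have /andP[uK0 uK1] := utK K.
  have H1 : 1 <= hsum t (u * t ^+ K) by rewrite hsum_ge1.
  rewrite exprn_ege1 //= -mulrA expRM_natl lerXn2r ?nnegrE ?expR_ge0 //.
    exact: le_trans H1.
  by apply: le_trans (expR_ge1Dx _); rewrite hsum_scale.
- exact: cvg_cst.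
have KtK : K%:R * t ^+ K * hsum t u @[K --> \oo] --> 0 * hsum t u.
  by apply: cvgM; [exact: cvg_natX_geom|exact: cvg_cst].
rewrite mul0r in KtK.
by have := cvg_comp _ _ KtK (@continuous_expR R 0); rewrite expR0.
Unshelve. all: by end_near.
Qed.

Lemma prod_hsum_le (R : realType) (t u : R) K : 0 < t -> t < 1 -> 0 <= u -> u < 1 ->
  \prod_(k < K) hsum t (u * t ^+ k) <= expR (hsum t u / (1 - t)).
Proof.
move=> t0 t1 u0 u1.
have H0 : 0 <= hsum t u by rewrite (le_trans ler01) // hsum_ge1.
apply: le_trans (prod_geom_le_expR K H0 (ltW t0) t1).
apply: ler_prod => k _.
have tk0 : 0 <= t ^+ k by rewrite exprn_ge0 // ltW.
have tk1 : t ^+ k <= 1 by rewrite exprn_ile1 // ltW.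
rewrite [hsum t u * _]mulrC hsum_scale // (le_trans ler01) // hsum_ge1 ?mulr_ge0 //.
by apply: le_lt_trans u1; rewrite ler_piMr.
Qed.

(** * The Cauchy sum over a box *)

Lemma ler_sum_sub (R : numDomainType) (I : eqType) (s1 s2 : seq I) (P : pred I)
    (F : I -> R) :
  (forall i, 0 <= F i) -> uniq s1 -> uniq s2 -> {subset s1 <= s2} ->
  \sum_(i <- s1 | P i) F i <= \sum_(i <- s2 | P i) F i.
Proof.
move=> F0 u1 u2 s12.
have -> : \sum_(i <- s1 | P i) F i = \sum_(i <- s2 | (i \in s1) && P i) F i.
  rewrite -big_filter_cond; apply: perm_big; apply: uniq_perm => //.
    exact: filter_uniq.
  by move=> i; rewrite mem_filter; apply/idP/andP => [i1|[]//]; rewrite i1 s12.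
rewrite [leRHS](bigID (mem s1)) /=; under eq_bigl do rewrite andbC.
by rewrite lerDl sumr_ge0.
Qed.

Lemma box_sub N n N' n' : (N <= N')%N -> (n <= n')%N ->
  {subset box N n <= box N' n'}.
Proof.
move=> NN nn la; rewrite !mem_box => /andP[laN lan].
by rewrite /in_box (leq_trans laN) ?(leq_trans lan).
Qed.

Lemma sub_box (s : seq intpart) : exists N, {subset s <= box N N}.
Proof.
elim: s => [|la s [N sN]]; first by exists 0%N.
exists (N + (size la + part la 0))%N => mu; rewrite inE => /predU1P[->|/sN].
  by rewrite mem_box /in_box; apply/andP; split; lia.
by apply: box_sub; rewrite leq_addr.
Qed.

Definition gen_sum (R : realType) (q z : R) (s : seq intpart) : R :=
  \sum_(la <- s) z ^+ part_size la * principal q la ^+ 2.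

Lemma gt1_exp_neq1 (R : realType) (q : R) : 1 < q ->
  forall k, q ^+ k.+1 - 1 != 0.
Proof. by move=> q1 k; rewrite gt_eqF // subr_gt0 exprn_egt1. Qed.

Lemma hook_gt0 (la : intpart) i j : (j < part la i)%N -> (0 < hook la i j)%N.
Proof.
move=> jla.
have il : (i < size la)%N by rewrite -intpart_gt0 (leq_trans _ jla).
have : (i < conj_part la j)%N; last by rewrite /hook; lia.
rewrite /conj_part -[X in count _ X](cat_take_drop i.+1) count_cat.
rewrite (leq_trans _ (leq_addr _ _)) //.
have sz : size (take i.+1 la) = i.+1 by rewrite size_takel.
rewrite -[X in (X <= _)%N]sz eq_leq //; apply/esym/eqP; rewrite -all_count.
apply/(all_nthP 0%N) => k; rewrite sz => ki; rewrite nth_take //.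
by apply: leq_trans jla _; apply: (@part_geq la).
Qed.

Lemma principal_gt0 (R : realType) (q : R) la : 1 < q -> 0 < principal q la.
Proof.
move=> q1; have q0 : 0 < q by apply: lt_trans q1.
rewrite mulr_gt0 ?exprn_gt0 // prodr_gt0 // => i _; rewrite prodr_gt0 // => j _.
have := hook_gt0 (ltn_ord j); case: (hook la i j) => // k _.
by rewrite invr_gt0 subr_gt0 exprn_egt1.
Qed.

(** One of the two factors g(la) is expanded by the branching rule. *)
Lemma gen_sum_cauchy (R : realType) (q u : R) N n : 1 < q ->
  gen_sum q u (box N n)
  = \sum_(mu <- box N n) q^-1 ^+ part_size mu * principal q mu *
      \sum_(la <- box N n | interlace mu la) u ^+ part_size la * principal q la.
Proof.
move=> q1; have q0 : q != 0 by rewrite gt_eqF // (lt_trans _ q1).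
rewrite /gen_sum.
transitivity (\sum_(la <- box N n) \sum_(mu <- box N n | interlace mu la)
   u ^+ part_size la * principal q la * (q^-1 ^+ part_size mu * principal q mu)).
  rewrite !big_seq; apply: eq_bigr => la; rewrite mem_box => la_box.
  by rewrite -mulr_sumr (branching q0 (gt1_exp_neq1 q1) la_box) expr2 mulrA.
rewrite (exchange_big_dep xpredT) //=; apply: eq_bigr => mu _.
by rewrite mulr_sumr; apply: eq_bigr => la _; rewrite mulrC.
Qed.

Lemma cvg_sumr (R : realType) (I : Type) (r : seq I) (P : pred I)
    (f : I -> nat -> R) (l : I -> R) :
  (forall i, P i -> f i @ \oo --> l i) ->
  \sum_(i <- r | P i) f i n @[n --> \oo] --> \sum_(i <- r | P i) l i.
Proof.
move=> fl; elim: r => [|i r IHr].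
  by under eq_fun do rewrite big_nil; rewrite big_nil; exact: cvg_cst.
under eq_fun do rewrite big_cons; rewrite big_cons.
by case: ifP => // /fl fi; exact: cvgD.
Qed.

(** The error terms z^k h_k of [pieri] are the terms of a convergent series. *)
Lemma pieri_cvg (R : realType) (q u : R) N n (mu : intpart) :
  1 < q -> 0 < u -> u < 1 -> mu \in box N n ->
  \sum_(la <- box N.+1 m | interlace mu la) u ^+ part_size la * principal q la
    @[m --> \oo] --> hsum q^-1 u * (u ^+ part_size mu * principal q mu).
Proof.
move=> q1 u0 u1; rewrite mem_box => mu_box.
have q0 : 0 < q by apply: lt_trans q1.
have t0 : 0 < q^-1 by rewrite invr_gt0.
have t1 : q^-1 < 1 by rewrite invf_lt1.
have [c cE] := pieri (lt0r_neq0 q0) (gt1_exp_neq1 q1) (lt0r_neq0 u0) mu_box.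
rewrite -(cvg_shiftn n) /=; under eq_fun do rewrite cE ?leq_addl //.
pose E m := psum (homog q^-1) u (m + N.+1) * (u ^+ part_size mu * principal q mu)
    + \sum_(j < N) u ^+ (m + j.+1) * homog q^-1 (m + j.+1)%N * c j.
suff : E @ \oo --> hsum q^-1 u * (u ^+ part_size mu * principal q mu).
  by rewrite -(cvg_shiftn n).
have cpsum := psum_cvg t0 t1 (ltW u0) u1.
have term0 : (fun k => u ^+ k * homog q^-1 k) @ \oo --> (0 : R).
  rewrite -(subrr (hsum q^-1 u)).
  have -> : (fun k => u ^+ k * homog q^-1 k)
          = (fun k => psum (homog q^-1) u k.+1 - psum (homog q^-1) u k).
    by apply/funext => k; rewrite /psum big_ord_recr /= addrAC subrr add0r.
  by apply: cvgB => //; rewrite cvg_shiftS.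
rewrite -[X in _ --> X]addr0; apply: cvgD.
  by apply: cvgM; [move: cpsum; rewrite -(cvg_shiftn N.+1)|exact: cvg_cst].
have S0 : \sum_(j < N) u ^+ (m + j.+1) * homog q^-1 (m + j.+1)%N * c j
    @[m --> \oo] --> \sum_(j < N) 0 * c j.
  apply: cvg_sumr => j _; apply: cvgM; last exact: cvg_cst.
  by move: term0; rewrite -(cvg_shiftn j.+1).
by rewrite [X in _ --> X]big1 in S0 => // j _; rewrite mul0r.
Qed.

Lemma pieri_le (R : realType) (q u : R) N n (mu : intpart) :
  1 < q -> 0 < u -> u < 1 -> mu \in box N n ->
  \sum_(la <- box N n | interlace mu la) u ^+ part_size la * principal q la
  <= hsum q^-1 u * (u ^+ part_size mu * principal q mu).
Proof.
move=> q1 u0 u1 mu_box; apply: cvgr_to_ge (pieri_cvg q1 u0 u1 mu_box) _.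
near=> m; apply: ler_sum_sub; rewrite ?box_uniq //.
  by move=> la; rewrite mulr_ge0 ?exprn_ge0 // ltW // principal_gt0.
by apply: box_sub => //; near: m; exact: nbhs_infty_ge.
Unshelve. all: by end_near.
Qed.

Lemma gen_sum_le_step (R : realType) (q u : R) N n : 1 < q -> 0 < u -> u < 1 ->
  gen_sum q u (box N n) <= hsum q^-1 u * gen_sum q (u * q^-1) (box N n).
Proof.
move=> q1 u0 u1; rewrite gen_sum_cauchy // /gen_sum mulr_sumr !big_seq.
have q0 : 0 < q by apply: lt_trans q1.
apply: ler_sum => mu mu_box.
rewrite exprMn; have := pieri_le q1 u0 u1 mu_box.
have g0 := ltW (principal_gt0 mu q1).
have tg : 0 <= q^-1 ^+ part_size mu * principal q mu.
  by rewrite mulr_ge0 // exprn_ge0 // invr_ge0 ltW.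
move=> /(ler_wpM2l tg) /le_trans; apply.
by rewrite le_eqVlt; apply/orP; left; apply/eqP; ring.
Qed.

(** For mu in the N x n box, the partitions interlacing with mu from above have at
    most N + 1 parts, and the truncated Pieri sums approach their limit once the
    box is wide enough. *)
Lemma gen_sum_gt_step (R : realType) (q u c : R) N n : 1 < q -> 0 < u -> u < 1 ->
  c < hsum q^-1 u * gen_sum q (u * q^-1) (box N n) ->
  exists N' n', c < gen_sum q u (box N' n').
Proof.
move=> q1 u0 u1 cH; have q0 : 0 < q by apply: lt_trans q1.
have tg mu : 0 <= q^-1 ^+ part_size mu * principal q mu.
  by rewrite mulr_ge0 ?exprn_ge0 ?invr_ge0 ?(ltW q0) // ltW // principal_gt0.
have ug la : 0 <= u ^+ part_size la * principal q la.
  by rewrite mulr_ge0 ?exprn_ge0 ?(ltW u0) // ltW // principal_gt0.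
pose G m := \sum_(mu <- box N n | mu \in box N n)
  q^-1 ^+ part_size mu * principal q mu *
  \sum_(la <- box N.+1 m | interlace mu la) u ^+ part_size la * principal q la.
have GH : G @ \oo --> hsum q^-1 u * gen_sum q (u * q^-1) (box N n).
  have -> : hsum q^-1 u * gen_sum q (u * q^-1) (box N n)
    = \sum_(mu <- box N n | mu \in box N n) q^-1 ^+ part_size mu * principal q mu *
       (hsum q^-1 u * (u ^+ part_size mu * principal q mu)).
    rewrite /gen_sum -big_seq mulr_sumr; apply: eq_bigr => mu _.
    by rewrite exprMn; ring.
  apply: cvg_sumr => mu mu_box.
  by apply: cvgM; [exact: cvg_cst|exact: pieri_cvg mu_box].
have : \forall m \near \oo, c < G m /\ (n <= m)%N.
  by near=> m; split; near: m; [exact: cvgr_gt GH _ cH|exact: nbhs_infty_ge].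
move=> /filter_ex[m [cG nm]]; exists N.+1, m; apply: lt_le_trans cG _.
rewrite gen_sum_cauchy // /G -big_seq.
apply: ler_sum_sub; rewrite ?box_uniq //; first by move=> mu; rewrite mulr_ge0 ?sumr_ge0.
exact: box_sub.
Unshelve. all: by end_near.
Qed.

(** Only the empty partition contributes a constant term in u. *)
Lemma gen_sum_scale (R : realType) (q u s : R) N n : 1 < q -> 0 <= u ->
  0 <= s -> s <= 1 ->
  gen_sum q (u * s) (box N n) <= 1 + s * gen_sum q u (box N n).
Proof.
move=> q1 u0 s0 s1; rewrite /gen_sum mulr_sumr.
apply: (@le_trans _ _ (\sum_(la <- box N n) ((la == empty_intpart)%:R +
    s * (u ^+ part_size la * principal q la ^+ 2)))).
  apply: ler_sum => la _.
  have [->|la0] := eqVneq la empty_intpart.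
    by rewrite principal0 expr0 expr1n !mulr1 lerDl.
  have : (0 < part_size la)%N.
    rewrite lt0n; apply: contraNneq la0 => la0; apply/eqP/intpart_ext => i.
    rewrite [RHS]part_default //; apply/eqP; rewrite -leqn0 -la0.
    have [il|li] := ltnP i (size la); last by rewrite part_default.
    by rewrite (part_size_rows (leqnn _)) (bigD1 (Ordinal il)) //= leq_addr.
  case: (part_size la) => // k _; rewrite add0r mulrA ler_wpM2r ?exprn_ge0 //.
    by rewrite ltW // principal_gt0.
  by rewrite exprMn mulrC ler_wpM2r ?exprn_ge0 // exprS ler_piMr // exprn_ile1.
rewrite big_split /= lerD2r -natr_sum lern1.
have -> : (\sum_(la <- box N n) (la == empty_intpart) = count_mem empty_intpart (box N n))%N.
  by rewrite -sum1_count [RHS]big_mkcond.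
by rewrite count_uniq_mem ?box_uniq // leq_b1.
Qed.

Lemma gen_sum_le_prod (R : realType) (q u : R) N n K : 1 < q -> 0 < u -> u < 1 ->
  gen_sum q u (box N n) <=
  (\prod_(k < K) hsum q^-1 (u * q^-1 ^+ k)) * gen_sum q (u * q^-1 ^+ K) (box N n).
Proof.
move=> q1 u0 u1; elim: K => [|K IHK]; first by rewrite big_ord0 mul1r expr0 mulr1.
have q0 : 0 < q by apply: lt_trans q1.
have t0 : 0 < q^-1 by rewrite invr_gt0.
have t1 : q^-1 < 1 by rewrite invf_lt1.
have utK k : 0 < u * q^-1 ^+ k < 1.
  rewrite mulr_gt0 ?exprn_gt0 //=; apply: le_lt_trans u1.
  by rewrite ler_piMr ?(ltW u0) // exprn_ile1 // ltW.
apply: le_trans IHK _; rewrite big_ord_recr /= -mulrA ler_wpM2l //.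
  apply: prodr_ge0 => k _; have /andP[uk0 uk1] := utK k.
  by rewrite (le_trans ler01) // hsum_ge1 // ltW.
have /andP[uk0 uk1] := utK K.
by rewrite exprSr mulrA gen_sum_le_step.
Qed.

Lemma gen_sum_gt_prod (R : realType) (q u c : R) K : 1 < q -> 0 < u -> u < 1 ->
  c < \prod_(k < K) hsum q^-1 (u * q^-1 ^+ k) ->
  exists N n, c < gen_sum q u (box N n).
Proof.
move=> q1; have q0 : 0 < q by apply: lt_trans q1.
have t0 : 0 < q^-1 by rewrite invr_gt0.
have t1 : q^-1 < 1 by rewrite invf_lt1.
elim: K u c => [|K IHK] u c u0 u1.
  rewrite big_ord0 => c1; exists 0%N, 0%N; apply: lt_le_trans c1 _.
  have -> : 1 = \sum_(la <- [:: empty_intpart]) u ^+ part_size la * principal q la ^+ 2.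
    by rewrite big_seq1 principal0 expr0 expr1n mulr1.
  apply: ler_sum_sub; rewrite ?box_uniq //.
    by move=> la; rewrite mulr_ge0 ?exprn_ge0 ?(ltW u0) // ltW // principal_gt0.
  by move=> la; rewrite inE => /eqP->; rewrite mem_box.
have ut0 : 0 < u * q^-1 by rewrite mulr_gt0.
have ut1 : u * q^-1 < 1 by rewrite mulr_ilt1 // ltW.
have H0 : 0 < hsum q^-1 u by rewrite (lt_le_trans ltr01) // hsum_ge1 // ltW.
rewrite big_ord_recl /= expr0 mulr1 mulrC -ltr_pdivrMr //.
under eq_bigr => k _ do rewrite /bump /= add1n exprS mulrA.
move=> /(IHK _ _ ut0 ut1)[N [n]]; rewrite ltr_pdivrMr // mulrC.
exact: gen_sum_gt_step.
Qed.

(** * Probabilities with prescribed point masses *)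

(** The point mass at the partition numbered k, if there is one. *)
Definition atom (R : realType) (a : intpart -> {nonneg R}) (k : nat) :
    {measure set intpart -> \bar R} :=
  if pickle_inv k is Some x then mscale (a x) (dirac x) else mzero.

Definition atomic (R : realType) (a : intpart -> {nonneg R}) :
    set intpart -> \bar R := mseries (atom a) 0.

HB.instance Definition _ (R : realType) (a : intpart -> {nonneg R}) :=
  Measure.on (atomic a).

Lemma atomic_set1 (R : realType) (a : intpart -> {nonneg R}) x :
  atomic a [set x] = ((a x)%:num)%:E.
Proof.
rewrite /atomic /mseries (@nneseriesD1 _ _ (pickle x)) //.
rewrite {1}/atom pickleK_inv /= /mscale /= diracE mem_set // mule1.
rewrite eseries0 ?adde0 // => k _ /= kx; rewrite /atom.
case: pickle_inv (pickle_invK (T := intpart) k) => [y /= yk|//].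
rewrite /mscale /= diracE memNset ?mule0 // => yx.
by rewrite -yk yx eqxx in kx.
Qed.

Lemma atomic_setT (R : realType) (a : intpart -> {nonneg R}) :
  (forall s, uniq s -> \sum_(x <- s) (a x)%:num <= 1) ->
  (forall c, c < 1 -> exists2 s, uniq s & c < \sum_(x <- s) (a x)%:num) ->
  atomic a setT = 1%E.
Proof.
move=> ub lb.
pose s n := pmap (@pickle_inv intpart) (iota 0 n).
have partial n : (\sum_(0 <= k < n) atom a k setT = (\sum_(x <- s n) (a x)%:num)%:E)%E.
  rewrite /s /index_iota subn0; elim: (iota 0 n) => [|k r IHr]; first by rewrite !big_nil.
  rewrite big_cons /= IHr /atom; case: pickle_inv => [x|] /=; last by rewrite add0e.
  by rewrite big_cons /mscale /= diracT mule1 EFinD.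
have s_uniq n : uniq (s n).
  by apply: pmap_uniq (iota_uniq _ _); exact: pickle_invK.
have ge0 k : (0 <= atom a k setT)%E by [].
have ub' : (atomic a setT <= 1)%E.
  apply: lime_le; first by apply: is_cvg_nneseries.
  by near=> n; rewrite partial lee_fin ub.
have lb' c : c < 1 -> (c%:E < atomic a setT)%E.
  move=> /lb[r r_uniq /lt_le_trans cr].
  have [n rn] : exists n, {subset r <= s n}.
    exists (\max_(x <- r) (pickle x).+1)%N => x xr.
    rewrite mem_pmap; apply/mapP; exists (pickle x); last by rewrite pickleK_inv.
    by rewrite mem_iota /= add0n; apply: (leq_bigmax_seq (F := fun x => (pickle x).+1)).
  apply: lt_le_trans (nneseries_lim_ge n _); last by [].
  by rewrite partial lte_fin cr // ler_sum_sub.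
move: ub' lb'; case: (atomic a setT) => [r|//|_ /(_ 0 ltr01)//].
rewrite lee_fin => r1 lb'; congr (_%:E); apply/eqP; rewrite eq_le r1 leNgt.
by apply/negP => /lb'; rewrite ltxx.
Unshelve. all: by end_near.
Qed.

(** For weights on a countable set, total mass 1 can be checked on finite sums:
    they are at most 1, and some of them are arbitrarily close to 1. *)
Lemma exists_probability (R : realType) (a : intpart -> R) :
  (forall x, 0 <= a x) ->
  (forall s, uniq s -> \sum_(x <- s) a x <= 1) ->
  (forall c, c < 1 -> exists2 s, uniq s & c < \sum_(x <- s) a x) ->
  exists P : probability intpart R, forall x, P [set x] = (a x)%:E.
Proof.
move=> a0 ub lb; pose b x : {nonneg R} := NngNum (a0 x).
have bT : atomic b setT = 1%E by exact: atomic_setT.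
pose mixin := Measure_isProbability.Build _ _ _ (atomic b) bT.
pose P : probability intpart R := HB.pack (atomic b) mixin.
by exists P => x; exact: (atomic_set1 b x).
Qed.

(** * Total mass *)

Lemma M_principal (R : realType) (v q : R) (la : intpart) : 1 < q ->
  M v q la = M_prefactor v q * ((v * q^-1) ^+ part_size la * principal q la ^+ 2).
Proof.
move=> q1; have q0 : q != 0 by rewrite gt_eqF // (lt_trans _ q1).
rewrite /M.
have -> : \prod_(i < size la) \prod_(j < part la i) (q ^+ hook la i j - 1) ^- 2
   = (\prod_(i < size la) \prod_(j < part la i) (q ^+ hook la i j - 1)^-1) ^+ 2
  :> R.
  rewrite -prodrXl; apply: eq_bigr => i _; rewrite -prodrXl.
  by apply: eq_bigr => j _; rewrite exprVn.
rewrite /principal; set P := (\prod_(i < _) _).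
have e : ((n_conj la + part_size la) * 2
          = 2 * n_conj la + part_size la + part_size la)%N by lia.
rewrite exprMn exprVn exprMn -[(q ^+ _) ^+ 2]exprM e.
by rewrite [q ^+ (_ + part_size la + _)]exprD; field; exact: expf_neq0.
Qed.

Lemma prefactorE (R : realType) (v q : R) N :
  \prod_(1 <= r < N.+1) (1 - v * q ^- r) ^+ r
  = \prod_(k < N) (1 - v * q^-1 * q^-1 ^+ k) ^+ k.+1.
Proof.
rewrite big_add1 big_mkord; apply: eq_bigr => k _.
by rewrite -exprVn [q^-1 ^+ k.+1]exprS mulrA.
Qed.

Theorem mainTheorem3 (R : realType) (v q : R)
    (hq : 1 < q) (hv0 : 0 < v) (hvq : v < q) :
  exists P : probability intpart R,
    forall la : intpart, P [set la] = (M v q la)%:E.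
Proof.
have q0 : 0 < q by apply: lt_trans hq.
pose t := q^-1; pose u := v * t.
have t0 : 0 < t by rewrite invr_gt0.
have t1 : t < 1 by rewrite invf_lt1.
have u0 : 0 < u by rewrite mulr_gt0.
have u1 : u < 1 by rewrite ltr_pdivrMr // mul1r.
pose D K := \prod_(k < K) (1 - u * t ^+ k) ^+ k.+1.
pose H K := \prod_(k < K) hsum t (u * t ^+ k).
pose C := M_prefactor v q.
have ut k : 0 < u * t ^+ k < 1.
  rewrite mulr_gt0 ?exprn_gt0 //=; apply: le_lt_trans u1.
  by rewrite ler_piMr ?(ltW u0) // exprn_ile1 // ltW.
have HD K : H K * D K = hsum t (u * t ^+ K) ^+ K by rewrite prod_hsum // ltW.
have HD1 : (fun K => H K * D K) @ \oo --> (1 : R).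
  by under eq_fun do rewrite HD; apply: hsum_pow_cvg => //; rewrite ltW.
have D_noninc : nonincreasing_seq D.
  apply/nonincreasing_seqP => K; rewrite /D big_ord_recr /= ler_piMr //.
    apply: prodr_ge0 => k _; have /andP[_ uk1] := ut k.
    by rewrite exprn_ge0 // subr_ge0 ltW.
  have /andP[uK0 uK1] := ut K.
  by rewrite exprn_ile1 ?subr_ge0 ?(ltW uK1) // gerBl ltW.
(* a positive lower bound for D, so that C > 0: H K * D K >= 1 and H is bounded *)
pose e := (expR (hsum t u / (1 - t)))^-1.
have e0 : 0 < e by rewrite invr_gt0 expR_gt0.
have De K : e <= D K.
  have D0 : 0 <= D K.
    apply: prodr_ge0 => k _; have /andP[_ uk1] := ut k.
    by rewrite exprn_ge0 // subr_ge0 ltW.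
  rewrite -[leLHS]mul1r ler_pdivrMr ?expR_gt0 // mulrC.
  apply: (@le_trans _ _ (H K * D K)).
    have /andP[uK0 uK1] := ut K.
    by rewrite HD exprn_ege1 // hsum_ge1 // ltW.
  by rewrite ler_wpM2r // prod_hsum_le // ltW.
have D_cvg : cvgn D.
  by apply: nonincreasing_is_cvgn => //; exists e => _ [K _ <-].
have CE : C = limn D.
  by rewrite /C /M_prefactor; under eq_fun do rewrite prefactorE.
have C0 : 0 < C.
  by rewrite (lt_le_trans e0) // CE; apply: limr_ge => //; near=> K.
have DC : D @ \oo --> C by rewrite CE.
pose a la := C * (u ^+ part_size la * principal q la ^+ 2).
have F0 la : 0 <= u ^+ part_size la * principal q la ^+ 2.
  by rewrite mulr_ge0 ?exprn_ge0 ?(ltW u0) // ltW // principal_gt0.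
have sumE s : \sum_(la <- s) a la = C * gen_sum q u s by rewrite -mulr_sumr.
have [|||P PE] := @exists_probability R a.
- by move=> la; rewrite mulr_ge0 // ltW.
- move=> s s_uniq; have [N sN] := sub_box s; rewrite sumE.
  apply: (@le_trans _ _ (C * gen_sum q u (box N N))).
    by rewrite ler_wpM2l ?(ltW C0) // ler_sum_sub // box_uniq.
  set F := gen_sum q u (box N N).
  have F_ge0 : 0 <= F by rewrite sumr_ge0.
  (* F <= H K * gen_sum q (u t^K) <= H K * (1 + t^K F); multiply by D K *)
  have tF : (fun K => H K * D K * (1 + t ^+ K * F)) @ \oo --> (1 * (1 + 0 * F) : R).
    apply: cvgM => //; apply: cvgD; first exact: cvg_cst.
    apply: cvgM; last exact: cvg_cst.
    by apply: cvg_expr; rewrite gtr0_norm.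
  rewrite mul0r addr0 mulr1 in tF; apply: cvgr_to_ge tF _; near=> K.
  apply: (@le_trans _ _ (D K * F)).
    by rewrite ler_wpM2r // CE nonincreasing_cvgn_ge.
  rewrite [leRHS]mulrAC [leRHS]mulrC ler_wpM2l ?(le_trans (ltW e0)) //.
  apply: le_trans (gen_sum_le_prod N N K hq u0 u1) _.
  rewrite ler_wpM2l //.
    apply: prodr_ge0 => k _; have /andP[uk0 uk1] := ut k.
    by rewrite (le_trans ler01) // hsum_ge1 // ltW.
  by rewrite gen_sum_scale ?exprn_ge0 ?exprn_ile1 // ltW.
- move=> c c1.
  (* H K * C also tends to 1, hence exceeds c for some K *)
  have HC : (fun K => H K * D K * (C * (D K)^-1)) @ \oo --> (1 * (C * C^-1) : R).
    apply: cvgM => //; apply: cvgM; first exact: cvg_cst.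
    by apply: cvgV => //; rewrite gt_eqF.
  rewrite mul1r divff ?gt_eqF // in HC.
  have [K cK] : exists K, c < H K * C.
    have : \forall K \near \oo, c < H K * D K * (C / D K) by exact: cvgr_gt HC _ c1.
    move=> /filter_ex[K cK]; exists K.
    rewrite (lt_le_trans cK) // le_eqVlt; apply/orP; left; apply/eqP.
    have DK : D K != 0 by rewrite gt_eqF // (lt_le_trans e0).
    by field.
  have [|N [n cF]] := @gen_sum_gt_prod R q u (c / C) K hq u0 u1.
    by rewrite ltr_pdivrMr.
  exists (box N n); first exact: box_uniq.
  by rewrite sumE mulrC -ltr_pdivrMr.
by exists P => la; rewrite PE M_principal.
Unshelve. all: by end_near.
Qed.
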